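(* Let $X$ be a non-degenerate real-valued random variable with probability distribution $\mu$, and let $G:(0,1)\to(-\infty,\infty)$ be $G(t)=\inf\{u\in\mathbb{R}: \mu((-\infty,u])\ge t\}$. Then, for each $p\in(0,1)$, $X$ admits a decomposition of the form $$X \ \stackrel{\mathcal D}{=}\ Y_p(t)+\delta_p^+(t)\,\eta ,$$ in the sense of equality of the corresponding probability distributions, where: (1) $\eta$ and $t$ are independent random variables, with $\eta$ a binary variable taking the values $\{0,1\}$ with probabilities $\{1-p,p\}$, correspondingly, and $t$ having the uniform distribution in $(0,1)$; (2) $Y_p:(0,1)\to(-\infty,\infty)$ is the monotone non-decreasing function $Y_p(t):=G((1-p)t)$; (3) $\delta_p^+:(0,1)\to[0,\infty)$ is the function $\delta_p^+(t):=G(1-p+pt)-G((1-p)t)$; (4) for at least one value of $p\in(0,1)$ we have $$\beta^+(p,\mu):=\inf_{t\in(0,1)}\delta_p^+(t)>0 .$$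
   Context: A real random variable is non-degenerate if its distribution is not concentrated at a single point. $\stackrel{\mathcal D}{=}$ denotes equality of probability distributions. *)

(* Defs.v *)
From mathcomp Require Import all_boot all_order all_algebra.
From mathcomp Require Import all_classical all_reals all_analysis.

Set Implicit Arguments.
Unset Strict Implicit.
Unset Printing Implicit Defensive.

Import Order.TTheory GRing.Theory Num.Theory.
Import numFieldNormedType.Exports.

Local Open Scope classical_set_scope.
Local Open Scope ring_scope.

Definition has_law (R : realType) d (T : measurableType d)
    (P : probability T R) (X : {RV P >-> R}) (mu : probability R R) : Prop :=
  forall A : set R, measurable A -> distribution P X A = mu A.

(* The two variables may live on different probability spaces. *)
Definition eq_in_law (R : realType) d1 (T1 : measurableType d1)
    d2 (T2 : measurableType d2) (P1 : probability T1 R) (P2 : probability T2 R)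
    (X1 : {RV P1 >-> R}) (X2 : {RV P2 >-> R}) : Prop :=
  forall A : set R, measurable A ->
    distribution P1 X1 A = distribution P2 X2 A.

Definition nondegenerate_law (R : realType) (mu : probability R R) : Prop :=
  ~ exists c : R, mu [set c] = 1%E.

(* [inf] on R is total, with a default value when there is no real infimum;
   by [has_inf_quantile], the default is never used for 0 < t < 1. *)
Definition quantile (R : realType) (mu : probability R R) (t : R) : R :=
  inf [set u : R | (t%:E <= mu `]-oo, u]%classic)%E].

Lemma has_inf_quantile (R : realType) (mu : probability R R) (t : R) :
  0 < t < 1 -> has_inf [set u : R | (t%:E <= mu `]-oo, u]%classic)%E].
Proof.
move=> /andP[t0 t1].
pose X : {RV mu >-> R} := mfun_Sub (mem_set (@measurable_id _ R setT)).
split.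
- have t1E : (t%:E < 1)%E by rewrite lte_fin.
  have /filter_ex[u /= tu] : \forall u \near +oo, (t%:E < cdf X u)%E.
    exact: (cvg_cdfy1 X (open_ereal_gt' t1E)).
  by exists u; exact: ltW.
- have t0E : (0 < t%:E)%E by rewrite lte_fin.
  have /filter_ex[l /= lt_l] : \forall u \near -oo, (cdf X u < t%:E)%E.
    exact: (cvg_cdfNy0 X (open_ereal_lt' t0E)).
  exists l => u /= tu; rewrite leNgt; apply/negP => /ltW ul.
  have := lt_le_trans lt_l tu.
  by rewrite ltNge => /negP; apply; exact: (cdf_nondecreasing X ul).
Qed.

Definition Yp (R : realType) (mu : probability R R) (p t : R) : R :=
  quantile mu ((1 - p) * t).

Definition delta_plus (R : realType) (mu : probability R R) (p t : R) : R :=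
  quantile mu (1 - p + p * t) - quantile mu ((1 - p) * t).

Definition beta_plus (R : realType) (p : R) (mu : probability R R) : R :=
  inf [set delta_plus mu p t | t in `]0, 1[%classic].

Definition independent_RV (R : realType) d (T : measurableType d)
    (P : probability T R) (X1 X2 : {RV P >-> R}) : Prop :=
  forall A B : set R, measurable A -> measurable B ->
    P (X1 @^-1` A `&` X2 @^-1` B) = (P (X1 @^-1` A) * P (X2 @^-1` B))%E.

Definition bernoulli_RV (R : realType) d (T : measurableType d)
    (P : probability T R) (p : R) (eta : {RV P >-> R}) : Prop :=
  P (eta @^-1` [set 0]) = (1 - p)%:E /\ P (eta @^-1` [set 1]) = p%:E.

(* [uniform_prob] is defined by a density on [0, 1]; the endpoints are null, so
   this is the uniform distribution on (0, 1), and t lies in (0, 1) almost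
   surely. *)
Definition uniform01_RV (R : realType) d (T : measurableType d)
    (P : probability T R) (t : {RV P >-> R}) : Prop :=
  forall A : set R, measurable A ->
    distribution P t A = uniform_prob (@ltr01 R) A.

Definition bernoulli_uniform_pair (R : realType) d (T : measurableType d)
    (P : probability T R) (p : R) (eta t : {RV P >-> R}) : Prop :=
  [/\ independent_RV eta t, bernoulli_RV p eta & uniform01_RV t].

(* Main.v *)
(* For 0 < t < 1, [quantile mu t <= x] iff [t <= mu ]-oo, x]] (a Galois
   connection), so [quantile mu] pushes the uniform law forward to [mu]. The
   variable equal to [(1 - p) t] when [eta = 0] and to [1 - p + p t] when
   [eta = 1] is uniform, which gives the decomposition. *)
Require Import Defs.
From mathcomp Require Import all_boot all_order all_algebra.
From mathcomp Require Import all_classical all_reals all_analysis.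
From mathcomp Require Import measurable_realfun lra.

Set Implicit Arguments.
Unset Strict Implicit.
Unset Printing Implicit Defensive.

Import Order.TTheory GRing.Theory Num.Theory.
Import numFieldNormedType.Exports.

Local Open Scope classical_set_scope.
Local Open Scope ring_scope.

(** * Monotonicity and measurability of the quantile function *)

(** Right-continuity of the distribution function makes the infimum attained: if it is at most [x],
    every [y > x] lies above some [u] with [t <= mu ]-oo, u]], hence [t <= mu ]-oo, y]], and [y]
    tends to [x] from the right. *)
Lemma quantile_le (R : realType) (mu : probability R R) (t x : R) :
  0 < t < 1 ->
  (quantile mu t <= x) = (t%:E <= mu `]-oo, x]%classic)%E.
Proof.
move=> t01; have [t_ne t_lb] := has_inf_quantile mu t01.
apply/idP/idP => [qx|tx]; last exact: ge_inf.
pose X : {RV mu >-> R} := mfun_Sub (mem_set (@measurable_id _ R setT)).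
apply: (cvge_to_ge (@cdf_right_continuous _ _ _ mu X x)).
near=> y.
have xy : 0 < y - x by rewrite subr_gt0; near: y; exact: nbhs_right_gt.
have [u /= tu uq] := inf_adherent xy (conj t_ne t_lb).
apply: (le_trans tu); apply: (cdf_nondecreasing X).
by apply/ltW/(lt_le_trans uq); rewrite -lerBrDr opprB addrC subrK.
Unshelve. all: by end_near. Qed.

Lemma quantile_nondecreasing (R : realType) (mu : probability R R) :
  {in `]0, 1[ &, forall s t : R, s <= t -> quantile mu s <= quantile mu t}.
Proof.
move=> s t; rewrite !in_itv/= => s01 t01 st.
by rewrite quantile_le// (@le_trans _ _ t%:E)// -quantile_le.
Qed.

(** For [t <= 0] the set is all of the line, unbounded below; for [t > 1] it is empty. In both cases
    [inf] returns its default value 0. *)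
Lemma quantile_out (R : realType) (mu : probability R R) (t : R) :
  (t <= 0) || (1 < t) -> quantile mu t = 0.
Proof.
case/orP => [t0|t1]; apply: inf_out => -[[u /= tu] [l /= lb]].
  have /lb : (t%:E <= mu `]-oo, (l - 1)%R]%classic)%E.
    by rewrite (le_trans _ (measure_ge0 _ _))// lee_fin.
  by rewrite lerBrDr gerDl ler10.
have := le_trans tu (probability_le1 mu (measurable_itv `]-oo, u])).
by rewrite lee_fin leNgt t1.
Qed.

Lemma measurable_quantile (R : realType) (mu : probability R R) :
  measurable_fun [set: R] (quantile mu).
Proof.
(* The point 1 is kept apart: depending on [mu], the quantile there is a true infimum or the
   default, but a singleton is harmless for measurability. *)
have -> : [set: R] = `]-oo, 0] `|` (`]0, 1[ `|` ([set 1] `|` `]1, +oo[)).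
  apply/esym; rewrite -subTset => t _ /=; rewrite !in_itv/= andbT.
  have [t0|t0] := leP t 0; [by left | right].
  by have [t1|t1|->] := ltgtP t 1; [left | right; right | right; left].
have m0 (D : set R) : (forall t, D t -> (t <= 0) || (1 < t)) ->
    measurable_fun D (quantile mu).
  move=> D0; apply: (@eq_measurable_fun _ _ R R D (cst (0 : R))) => [t|].
    by rewrite inE => /D0 tD; rewrite quantile_out.
  exact: measurable_cst.
have mU (D E : set R) : measurable D -> measurable E ->
    measurable_fun D (quantile mu) -> measurable_fun E (quantile mu) ->
    measurable_fun (D `|` E) (quantile mu).
  by move=> mD mE mfD mfE; apply/measurable_funU.
apply: (mU) => //; [by do ?apply: measurableU| |].
  by apply: m0 => t /=; rewrite in_itv/= => ->.
apply: (mU) => //; [exact: measurableU| |].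
  (* On []0, 1[] monotonicity makes the preimage of each ray [[r, +oo[] an interval. *)
  apply: (measurability (@RGenCInfty.G R)) => [|/= _ [_] [r] -> <-].
    exact: RGenCInfty.measurableE.
  apply: is_interval_measurable => s t/=.
  rewrite !in_itv/= !andbT => -[s01 qs] [t01 qt] u /andP[su ut].
  have u01 : 0 < u < 1.
    by case/andP: s01 => s0 _; case/andP: t01 => _ t1; apply/andP; split; lra.
  split; rewrite /= in_itv//= andbT (le_trans qs)//.
  by apply: quantile_nondecreasing; rewrite ?in_itv.
apply: (mU) => //; first exact: measurable_fun_set1.
by apply: m0 => t /=; rewrite in_itv/= andbT => ->; rewrite orbT.
Qed.

(** * Uniform and Bernoulli laws, and laws determined by rays *)

(** The intersection with []0, 1[] confines [t] to where [quantile_le] applies; the clamping allows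
    thresholds outside [[0, 1]], which occur when the event is split according to [eta]. *)
Lemma uniform01_itv (R : realType) (c : R) :
  uniform_prob (@ltr01 R) (`]0, 1[ `&` `]-oo, c]) =
  (Num.min 1 (Num.max 0 c))%:E.
Proof.
have unifE (A : set R) : measurable A -> A `<=` `[0, 1] ->
    uniform_prob (@ltr01 R) A = lebesgue_measure A.
  move=> mA A01; rewrite /uniform_prob (eq_integral (cst 1%E)).
    by rewrite integral_cst//= mul1e.
  move=> t /[1!inE] /A01/=; rewrite in_itv/= /uniform_pdf => ->.
  by rewrite subr0 invr1.
rewrite unifE; last 2 first.
- exact: measurableI.
- by move=> t [/=]; rewrite !in_itv/= => /andP[/ltW -> /ltW ->].
have [c0|c0] := leP c 0.
  rewrite min_r ?ler01// (_ : _ `&` _ = set0) ?measure0//.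
  rewrite -subset0 => t [/=]; rewrite !in_itv/= => /andP[t0 _] tc.
  by have := lt_le_trans t0 (le_trans tc c0); rewrite ltxx.
have [c1|c1] := leP 1 c.
  rewrite setIidl ?lebesgue_measure_itv/= ?lte_fin ?ltr01 ?sube0//.
  by move=> t /=; rewrite !in_itv/= => /andP[_ /ltW t1]; exact: le_trans c1.
have -> : `]0, 1[ `&` `]-oo, c] = `]0, c]%classic.
  apply/seteqP; split => t /=; rewrite !in_itv/=; first by case=> /andP[-> _].
  by move=> /andP[-> tc]; rewrite (le_lt_trans tc c1).
by rewrite lebesgue_measure_itv/= lte_fin c0 sube0.
Qed.

Lemma probability_setI1 (R : realType) d (T : measurableType d)
    (P : probability T R) (A B : set T) :
  measurable A -> measurable B -> P B = 1%E -> P (A `&` B) = P A.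
Proof.
move=> mA mB PB.
rewrite [RHS](measureDI P mA mB) [X in (X + _)%E](_ : _ = 0%E) ?add0e//.
apply: (@subset_measure0 _ _ _ P _ (~` B)).
- exact: measurableD.
- exact: measurableC.
- by move=> x [].
- by apply: etrans (probability_setC P mB) _; rewrite PB subee.
Qed.

(** The rays are closed under intersection, generate the Borel sets since []a, b]] is a difference
    of two of them, and those ending at natural numbers exhaust the line with finite mass. *)
Lemma eq_probability_itvNyc (R : realType) (m1 m2 : probability R R) :
  (forall x, m1 `]-oo, x]%classic = m2 `]-oo, x]%classic) ->
  forall A, measurable A -> m1 A = m2 A.
Proof.
move=> m12; pose G : set (set R) := [set A | exists x, A = `]-oo, x]%classic].
apply: (@measure_unique _ R _ G (fun n => `]-oo, n%:R]%classic)).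
- rewrite eqEsubset; split => A.
    apply: smallest_sub; first exact: smallest_sigma_algebra.
    move=> _ [[a b]] _ <-/=.
    rewrite (_ : `]a, b]%classic = `]-oo, b] `\` `]-oo, a]); last first.
      apply/seteqP; split => t /=; rewrite !in_itv/=.
        by move=> /andP[lt_at ->]; rewrite leNgt lt_at.
      by move=> [-> /negP]; rewrite -ltNge => ->.
    by apply: (@measurableD _ (g_sigma_algebraType G));
      apply: sub_sigma_algebra; [exists b | exists a].
  apply: smallest_sub; first exact: smallest_sigma_algebra.
  by move=> _ [x ->]; exact: measurable_itv.
- move=> _ _ [x ->] [y ->]; exists (Num.min x y).
  by apply/seteqP; split => t /=; rewrite !in_itv/= le_min;
    [case=> -> | move/andP].
- by move=> n; exists n%:R.
- rewrite -subTset => t _; exists (Num.truncn t).+1 => //=.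
  by rewrite in_itv/= ltW// truncnS_gt.
- by move=> _ [x ->]; exact: m12.
- by move=> n; rewrite (le_lt_trans (probability_le1 _ _)) ?ltry.
Qed.

Lemma uniform01_RV_itv (R : realType) d (T : measurableType d)
    (P : probability T R) (t : {RV P >-> R}) (c : R) : uniform01_RV t ->
  P (t @^-1` (`]0, 1[ `&` `]-oo, c])) = (Num.min 1 (Num.max 0 c))%:E.
Proof. by move=> tU; rewrite -uniform01_itv -tU//; exact: measurableI. Qed.

Lemma uniform01_RV_itvoo (R : realType) d (T : measurableType d)
    (P : probability T R) (t : {RV P >-> R}) : uniform01_RV t ->
  P (t @^-1` `]0, 1[) = 1%E.
Proof.
move=> tU; have := uniform01_RV_itv 1 tU.
rewrite (max_r ler01) minxx setIidl//.
by move=> s /=; rewrite !in_itv/= => /andP[_ /ltW].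
Qed.

Lemma bernoulli_RV_support (R : realType) d (T : measurableType d)
    (P : probability T R) (p : R) (eta : {RV P >-> R}) : bernoulli_RV p eta ->
  P (eta @^-1` [set 0] `|` eta @^-1` [set 1]) = 1%E.
Proof.
move=> [eta0 eta1].
have -> : 1%E = (P (eta @^-1` [set 0%R]) + P (eta @^-1` [set 1%R]))%E.
  by rewrite eta0 eta1 -EFinD subrK.
apply: measureU.
- exact: measurable_funPTI.
- exact: measurable_funPTI.
- rewrite -subset0 => w [/= -> /eqP]; by rewrite eq_sym oner_eq0.
Qed.

(* Total probability for the event [U <= F], with [U] uniform on (0, 1) split
   at [1 - p] into two pieces that are again uniform. *)
Lemma min_max_mix (R : realType) (p F : R) : 0 < p < 1 -> 0 <= F <= 1 ->
  (1 - p) * Num.min 1 (Num.max 0 (F / (1 - p))) +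
  p * Num.min 1 (Num.max 0 ((F - (1 - p)) / p)) = F.
Proof.
move=> /andP[p0 p1] /andP[F0 F1]; have q0 : 0 < 1 - p by rewrite subr_gt0.
rewrite [Num.max 0 (F / _)]max_r ?divr_ge0 ?(ltW q0)//.
have [Fq|qF] := leP F (1 - p).
  rewrite min_r ?ler_pdivrMr ?mul1r//.
  rewrite [Num.max _ _]max_l; last by rewrite pmulr_lle0 ?invr_gt0// subr_le0.
  by rewrite min_r ?ler01// mulr0 addr0 mulrC divfK ?gt_eqF.
rewrite min_l; last by rewrite ler_pdivlMr ?mul1r ?ltW.
rewrite max_r; last by rewrite divr_ge0 ?(ltW p0)// subr_ge0 ltW.
rewrite min_r; last by rewrite ler_pdivrMr// mul1r; lra.
by rewrite [p * _]mulrC divfK ?gt_eqF// mulr1 addrC subrK.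
Qed.

(** * The law of the decomposed variable, and existence of the pair *)

Lemma mix01 (R : realType) (p t : R) : 0 < p < 1 -> 0 < t < 1 ->
  [/\ 0 < (1 - p) * t < 1, 0 < 1 - p + p * t < 1,
      (1 - p) * t <= 1 - p & 1 - p <= 1 - p + p * t].
Proof.
by move=> /andP[p0 p1] /andP[t0 t1]; split; try (apply/andP; split); nra.
Qed.

Lemma Yp_add_delta_plus (R : realType) (mu : probability R R) (p t : R) :
  Yp mu p t + delta_plus mu p t = quantile mu (1 - p + p * t).
Proof. by rewrite /Yp /delta_plus addrC subrK. Qed.

Lemma distribution_Yp_delta_plus (R : realType) (mu : probability R R) (p : R)
    d (T : measurableType d) (P : probability T R) (eta t Z : {RV P >-> R}) :
  0 < p < 1 -> bernoulli_uniform_pair p eta t ->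
  (forall w, Z w = Yp mu p (t w) + delta_plus mu p (t w) * eta w) ->
  forall A, measurable A -> distribution P Z A = mu A.
Proof.
move=> p01 [indep eta01 tU] ZE; have /andP[p0 p1] := p01.
have q0 : 0 < 1 - p by rewrite subr_gt0.
apply: eq_probability_itvNyc => x.
have muE : mu `]-oo, x]%classic = (fine (mu `]-oo, x]%classic))%:E.
  by rewrite fineK// fin_num_measure.
have F01 : 0 <= fine (mu `]-oo, x]%classic) <= 1.
  by rewrite -!lee_fin -muE measure_ge0 probability_le1.
move: (fine _) muE F01 => F muE F01.
pose A c : set R := `]0, 1[ `&` `]-oo, c].
have mA c : measurable (A c) by exact: measurableI.
(* The hypotheses place [t] in []0, 1[] and [eta] in [{0, 1}] only almost surely, so the event is
   first restricted to this set of full probability. *)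
pose E := t @^-1` `]0, 1[ `&` (eta @^-1` [set 0] `|` eta @^-1` [set 1]).
have mE0 : measurable (eta @^-1` [set 0] `|` eta @^-1` [set 1]).
  by apply: measurableU; exact: measurable_funPTI.
have mt : measurable (t @^-1` `]0, 1[) by exact: measurable_funPTI.
have PE : P E = 1%E.
  rewrite probability_setI1 ?uniform01_RV_itvoo//.
  exact: bernoulli_RV_support eta01.
have mZ : measurable (Z @^-1` `]-oo, x]) by exact: measurable_funPTI.
transitivity (P (Z @^-1` `]-oo, x] `&` E)).
  by rewrite probability_setI1//; exact: measurableI.
(* By [quantile_le], [Z <= x] means [(1 - p) t <= F] where [eta = 0] and [1 - p + p t <= F] where
   [eta = 1]; solving for [t] gives the two thresholds. *)
have -> : Z @^-1` `]-oo, x] `&` E =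
    (eta @^-1` [set 0] `&` t @^-1` A (F / (1 - p))) `|`
    (eta @^-1` [set 1] `&` t @^-1` A ((F - (1 - p)) / p)).
  have le0 w : 0 < t w < 1 -> eta w = 0 ->
      (Z w <= x) = (t w <= F / (1 - p)).
    move=> tw e0; have [u01 _ _ _] := mix01 p01 tw.
    by rewrite ZE e0 mulr0 addr0 quantile_le// muE lee_fin ler_pdivlMr// mulrC.
  have le1 w : 0 < t w < 1 -> eta w = 1 ->
      (Z w <= x) = (t w <= (F - (1 - p)) / p).
    move=> tw e1; have [_ u01 _ _] := mix01 p01 tw.
    rewrite ZE e1 mulr1 Yp_add_delta_plus quantile_le// muE lee_fin.
    by rewrite ler_pdivlMr// lerBrDl [t w * p]mulrC.
  apply/seteqP; split => w /=; rewrite !in_itv/=.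
    by move=> [Zx [tw [e|e]]]; [left | right]; do 2 split=> //;
      rewrite /= in_itv/= -?le0 -?le1.
  move=> [] [e []]; rewrite /= !in_itv/= => tw.
    by rewrite -le0// => Zx; split=> //; split=> //; left.
  by rewrite -le1// => Zx; split=> //; split=> //; right.
transitivity (P (eta @^-1` [set 0%R] `&` t @^-1` A (F / (1 - p))%R) +
    P (eta @^-1` [set 1%R] `&` t @^-1` A ((F - (1 - p)) / p)%R))%E; last first.
  rewrite !indep// !uniform01_RV_itv// muE; have [-> ->] := eta01.
  by rewrite -!EFinM -EFinD min_max_mix.
apply: measureU.
- by apply: measurableI; exact: measurable_funPTI.
- by apply: measurableI; exact: measurable_funPTI.
- rewrite -subset0 => w [[/= -> _] [/eqP]]; by rewrite eq_sym oner_eq0.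
Qed.

Lemma measurable_Yp_delta_plus (R : realType) (mu : probability R R) (p : R)
    d (T : measurableType d) (eta t : T -> R) :
  measurable_fun setT eta -> measurable_fun setT t ->
  measurable_fun setT
    (fun w => Yp mu p (t w) + delta_plus mu p (t w) * eta w).
Proof.
move=> meta mt.
have mY : measurable_fun setT (fun w => quantile mu ((1 - p) * t w)).
  apply: measurableT_comp; first exact: measurable_quantile.
  exact: measurable_funM.
apply: measurable_funD => //; apply: measurable_funM => //.
apply: measurable_funB => //.
apply: measurableT_comp; first exact: measurable_quantile.
by apply: measurable_funD => //; exact: measurable_funM.
Qed.

(** The two coordinates of the product of a Bernoulli and a uniform space form such a pair, so the
    decomposition is not vacuous. *)
Lemma bernoulli_uniform_pair_exists (R : realType) (p : R) : 0 <= p <= 1 ->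
  exists (d : measure_display) (T : measurableType d) (P : probability T R)
    (eta t : {RV P >-> R}), bernoulli_uniform_pair p eta t.
Proof.
move=> p01.
pose B : probability bool R := bernoulli_prob p.
pose U : probability (measurableTypeR R) R := uniform_prob (@ltr01 R).
pose P : probability (bool * measurableTypeR R)%type R := (B \x U)%E.
have meta :
    measurable_fun setT (fun w : bool * measurableTypeR R => w.1%:R : R).
  by apply: (@measurableT_comp _ _ _ _ _ _ (fun b : bool => b%:R : R)).
pose t_ (w : bool * measurableTypeR R) : R := w.2.
have mt : measurable_fun setT t_.
  exact: measurable_snd.
pose eta : {RV P >-> R} := mfun_Sub (mem_set meta).
pose t : {RV P >-> R} := mfun_Sub (mem_set mt).
have prodE (C D : set R) : measurable D ->
    P (eta @^-1` C `&` t @^-1` D) = (B [set b | C b%:R] * U D)%E.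
  by move=> mD; rewrite -product_measure1E.
have etaE (C : set R) : P (eta @^-1` C) = B [set b | C b%:R].
  have := prodE C setT measurableT; rewrite preimage_setT setIT => ->.
  by rewrite probability_setT mule1.
have tE (D : set R) : measurable D -> P (t @^-1` D) = U D.
  move=> mD; have := prodE setT D mD; rewrite preimage_setT setTI => ->.
  by rewrite [X in (X * _)%E]probability_setT mul1e.
exists _, _, P, eta, t; split.
- by move=> C D mC mD; rewrite prodE// etaE tE.
- have BE b : B [set b] = (bernoulli_pmf p b)%:E.
    by rewrite /B/= /bernoulli_prob p01 fsbig_set1.
  split; rewrite etaE; [rewrite -(BE false) | rewrite -(BE true)]; congr (B _);
    apply/seteqP; split => [[]|_ ->]//= /eqP; rewrite ?oner_eq0 //;
    by rewrite eq_sym oner_eq0.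
- by move=> A mA; exact: tE.
Qed.

(** * Positivity of the infimum for a suitable [p] *)

Lemma beta_plus_ge (R : realType) (mu : probability R R) (p c : R) :
  (forall t, 0 < t < 1 -> c <= delta_plus mu p t) -> c <= beta_plus p mu.
Proof.
move=> cd; apply: lb_le_inf.
  (* Nonemptiness excludes the default value of [inf]. *)
  by exists (delta_plus mu p 2^-1); exists 2^-1 => //=; rewrite in_itv/=; lra.
by move=> _ [t /= t01 <-]; apply: cd; rewrite in_itv in t01.
Qed.

(* If the quantile function were constant, the decomposition itself would
   exhibit [mu] as the law of a constant. *)
Lemma quantile_nonconstant (R : realType) (mu : probability R R) :
  nondegenerate_law mu ->
  exists a b : R, [/\ 0 < a < 1, 0 < b < 1 & quantile mu a < quantile mu b].
Proof.
move=> nondeg; apply: contrapT => noab; apply: nondeg.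
(* One half is an arbitrary point of []0, 1[], serving both as reference argument of the quantile
   and as the weight [p]. *)
have h01 : 0 < (2^-1 : R) < 1 by lra.
exists (quantile mu 2^-1).
have cstE s : 0 < s < 1 -> quantile mu s = quantile mu 2^-1.
  move=> s01; apply/eqP; rewrite eq_le; apply/andP; split;
    rewrite leNgt; apply/negP => lt_q; apply: noab.
    by exists 2^-1, s.
  by exists s, 2^-1.
have h01' : 0 <= (2^-1 : R) <= 1 by lra.
have [d [T [P [eta [t etat]]]]] := bernoulli_uniform_pair_exists h01'.
have mZ := @measurable_Yp_delta_plus R mu 2^-1 d T eta t
  (measurable_funPT eta) (measurable_funPT t).
pose Z : {RV P >-> R} := mfun_Sub (mem_set mZ).
rewrite -(@distribution_Yp_delta_plus R mu 2^-1 d T P eta t Z)//.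
have [_ _ tU] := etat.
apply/eqP; rewrite eq_le; apply/andP; split.
  exact: probability_le1.
(* Wherever [t] lies in []0, 1[], [delta_plus] vanishes and [Z] is the constant, whatever [eta]
   is. *)
rewrite -(uniform01_RV_itvoo tU); apply: le_measure.
- by rewrite inE; exact: measurable_funPTI.
- by rewrite inE; exact: measurable_funPTI.
- move=> w /=; rewrite in_itv/= => tw.
  have [u0 u1 _ _] := mix01 h01 tw.
  by rewrite /delta_plus !cstE// subrr mul0r addr0 /Yp cstE.
Qed.

(* Take [v] strictly between two values of the quantile function [G] and let
   [q] be the mass of []-oo, v]], so that [G <= v] exactly on ]0, q]. For
   [p = 1 - q], either [G q] is at most the lower value, and then [v] separates
   both sides of [q] uniformly in [t]; or [G] increases strictly both somewhere
   to the left of [q] and immediately to the right of [q], which bounds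
   [delta_plus] below for small and for large [t] respectively. *)
Lemma beta_plus_gt0 (R : realType) (mu : probability R R) :
  nondegenerate_law mu -> exists2 p, 0 < p < 1 & 0 < beta_plus p mu.
Proof.
move=> /quantile_nonconstant[a [b [a01 b01 Gab]]].
have [v /andP[av vb]] : exists v, quantile mu a < v < quantile mu b.
  by exists ((quantile mu a + quantile mu b) / 2); apply/andP; split; lra.
pose q := fine (mu `]-oo, v]%classic).
have muE : mu `]-oo, v]%classic = q%:E.
  by rewrite fineK// fin_num_measure.
have qE s : 0 < s < 1 -> (quantile mu s <= v) = (s <= q).
  by move=> s01; rewrite quantile_le// muE lee_fin.
have aq : a <= q by rewrite -qE// ltW.
have qb : q < b by rewrite ltNge -qE// -ltNge.
have [a0 a1] := andP a01; have [b0 b1] := andP b01.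
have q0 : 0 < q by exact: lt_le_trans aq.
have q1 : q < 1 by exact: lt_trans b1.
have q01 : 0 < q < 1 by rewrite q0.
have Gq : quantile mu q <= v by rewrite qE.
have Gmono := quantile_nondecreasing mu.
pose p := 1 - q.
have p01 : 0 < p < 1 by rewrite /p; lra.
have pE : 1 - p = q by rewrite /p subKr.
exists p => //.
have lo t : 0 < t < 1 -> quantile mu (q * t) <= quantile mu q.
  move=> t01; have [] := mix01 p01 t01; rewrite pE => u01 _ uq _.
  by apply: Gmono; rewrite ?in_itv.
have hi t : 0 < t < 1 -> v <= quantile mu (q + p * t).
  move=> t01; have [] := mix01 p01 t01; rewrite pE => _ u01 _ _.
  rewrite ltW// ltNge qE// -ltNge ltrDl mulr_gt0//; lra.
have [Gqa|Gaq] := leP (quantile mu q) (quantile mu a).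
  apply: (@lt_le_trans _ _ (v - quantile mu a)); first by rewrite subr_gt0.
  apply: beta_plus_ge => t t01; rewrite /delta_plus pE.
  by apply: lerB; [exact: hi | exact: le_trans (lo t t01) Gqa].
have {}aq : a < q.
  by rewrite lt_neqAle aq andbT; apply: contraTneq Gaq => ->; rewrite ltxx.
(* The switch between small and large [t]: [q * t <= a] exactly when [t <= t0]. Below it the gap
   from [a] to [q] is crossed, above it the gap from [q] to [r]. *)
pose t0 := a / q.
have t001 : 0 < t0 < 1.
  by rewrite divr_gt0//= ltr_pdivrMr// mul1r.
have [_ r01 _ _] := mix01 p01 t001; rewrite pE in r01.
pose r := q + p * t0.
have Gr : quantile mu q < quantile mu r.
  apply: (le_lt_trans Gq); rewrite ltNge qE// -ltNge ltrDl mulr_gt0//; lra.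
apply: (@lt_le_trans _ _ (Num.min (quantile mu q - quantile mu a)
                                  (quantile mu r - quantile mu q))).
  by rewrite lt_min !subr_gt0 Gaq.
apply: beta_plus_ge => t t01; rewrite /delta_plus pE ge_min.
have [] := mix01 p01 t01; rewrite pE => u01 w01 uq qw.
have [tt0|t0t] := leP t t0.
  apply/orP; left; apply: lerB; apply: Gmono; rewrite ?in_itv//=.
  by rewrite mulrC -ler_pdivlMr.
apply/orP; right; apply: lerB; apply: Gmono; rewrite ?in_itv//=.
by rewrite lerD2l ler_wpM2l// ?ltW//; lra.
Qed.

Theorem theorem2p1 (R : realType) (d : measure_display) (T : measurableType d)
    (P : probability T R) (X : {RV P >-> R}) (mu : probability R R)
    (X_law : has_law X mu) (mu_nondeg : nondegenerate_law mu) :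
  (forall p : R, 0 < p < 1 ->
    [/\ {in `]0, 1[ &, forall s t : R, s <= t -> Yp mu p s <= Yp mu p t},
        {in `]0, 1[, forall t : R, 0 <= delta_plus mu p t},
        exists (d' : measure_display) (Omega : measurableType d')
          (Q : probability Omega R) (eta t : {RV Q >-> R}),
          bernoulli_uniform_pair p eta t
      & forall (d' : measure_display) (Omega : measurableType d')
          (Q : probability Omega R) (eta t : {RV Q >-> R}),
          bernoulli_uniform_pair p eta t ->
          exists2 Z : {RV Q >-> R},
            forall w : Omega,
              Z w = Yp mu p (t w) + delta_plus mu p (t w) * eta w
            & eq_in_law X Z])
  /\ (exists2 p : R, 0 < p < 1 & 0 < beta_plus p mu).
Proof.
split; last exact: beta_plus_gt0.
move=> p p01; have Gmono := quantile_nondecreasing mu; split.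
- move=> s t; rewrite !in_itv/= => s01 t01 st.
  have [u01 _ _ _] := mix01 p01 s01; have [w01 _ _ _] := mix01 p01 t01.
  apply: Gmono; rewrite ?in_itv// ler_wpM2l//.
  by rewrite subr_ge0; case/andP: p01 => _ /ltW.
- move=> t; rewrite in_itv/= => t01; have [u01 w01 uq qw] := mix01 p01 t01.
  by rewrite subr_ge0; apply: Gmono; rewrite ?in_itv// (le_trans uq).
- by apply: bernoulli_uniform_pair_exists; case/andP: p01 => /ltW -> /ltW ->.
- move=> d' Omega Q eta t etat.
  have mZ := @measurable_Yp_delta_plus R mu p d' Omega eta t
    (measurable_funPT eta) (measurable_funPT t).
  pose Z : {RV Q >-> R} := mfun_Sub (mem_set mZ).
  exists Z => // A mA.
  by rewrite X_law// (@distribution_Yp_delta_plus R mu p d' Omega Q eta t Z).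
Qed.
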